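(* Let $E_\bullet$ be a function assigning a real number to every bipartite state, such that $E_\bullet(\sigma^{AB})\le \tfrac12 I^{A:B}(\sigma^{AB})$ for all bipartite states $\sigma^{AB}$. Let $\mathscr{H}^Q$ and $\mathscr{H}^{Q'}$ be finite-dimensional Hilbert spaces, $\rho^Q$ a state on $\mathscr{H}^Q$, and $\mathcal{E}$ a channel from states on $\mathscr{H}^Q$ to states on $\mathscr{H}^{Q'}$. Let $|\Psi^{RQ}\rangle$ be a purification of $\rho^Q$ with $\dim\mathscr{H}^R=\dim\mathscr{H}^Q$, let $\rho^{RQ'}:=(\mathrm{id}^R\otimes\mathcal{E})(|\Psi\rangle\langle\Psi|^{RQ})$, and define $\varepsilon_\bullet:=S(\rho^Q)-E_\bullet(\rho^{RQ'})$. Then there exists a channel $\mathcal{R}$ from states on $\mathscr{H}^{Q'}$ to states on $\mathscr{H}^Q$ such that $$F(\rho^Q,\mathcal{R}\circ\mathcal{E})\ \ge\ 1-2\sqrt{\varepsilon_\bullet}.$$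
   Context: A channel is a completely positive trace-preserving linear map. $S(\sigma):=-\operatorname{Tr}[\sigma\log_2\sigma]$ is the von Neumann entropy, and the quantum mutual information of a bipartite state is $I^{A:B}(\sigma^{AB}):=S(\sigma^A)+S(\sigma^B)-S(\sigma^{AB})$, with $\sigma^A,\sigma^B$ the reduced states. A purification of $\rho^Q$ is a unit vector $|\Psi^{RQ}\rangle\in\mathscr{H}^R\otimes\mathscr{H}^Q$ with $\operatorname{Tr}_R[|\Psi\rangle\langle\Psi|]=\rho^Q$. The entanglement fidelity is $F(\rho^Q,\mathcal{M}):=\langle\Psi^{RQ}|(\mathrm{id}^R\otimes\mathcal{M})(|\Psi\rangle\langle\Psi|^{RQ})|\Psi^{RQ}\rangle$ for a channel $\mathcal{M}$ on states of $\mathscr{H}^Q$. *)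

(* Defs.v *)
From HB Require Import structures.
From mathcomp Require Import all_boot all_order all_algebra.
From mathcomp Require Import classical_sets reals exp.
From mathcomp.real_closed Require Import complex mxtens.

Set Implicit Arguments.
Unset Strict Implicit.
Unset Printing Implicit Defensive.

Import Order.TTheory GRing.Theory Num.Theory.
Local Open Scope ring_scope.
Local Open Scope complex_scope.

Section Quantum.
Variable R : realType.
Local Notation C := R[i].

Definition adjmx {m n} (A : 'M[C]_(m, n)) : 'M[C]_(n, m) := (map_mx conjc A)^T.

Definition hermitian {n} (A : 'M[C]_n) : Prop := adjmx A = A.

(* positive semidefinite (order on C: 0 <= z iff z real and nonnegative) *)
Definition psd {n} (A : 'M[C]_n) : Prop :=
  hermitian A /\ forall v : 'cV[C]_n, 0 <= (adjmx v *m A *m v) 0 0.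

Definition is_state {n} (A : 'M[C]_n) : Prop := psd A /\ \tr A = 1.

Definition unitarymx {n} (U : 'M[C]_n) : Prop := U *m adjmx U = 1%:M.

Definition spectral_decomp {n} (A : 'M[C]_n) (lam : 'rV[R]_n) : Prop :=
  exists U : 'M[C]_n, unitarymx U /\
    A = U *m diag_mx (map_mx (fun x : R => x%:C) lam) *m adjmx U.

Definition eigvals {n} (A : 'M[C]_n) : 'rV[R]_n := xget 0 (spectral_decomp A).

(* von Neumann entropy S(s) = - Tr[s log2 s] = - sum_i l_i log2 l_i (0 log 0 = 0,
   which holds since ln 0 = 0 in MathComp-Analysis) *)
Definition vN_entropy {n} (s : 'M[C]_n) : R :=
  - \sum_(i < n) eigvals s 0 i * (ln (eigvals s 0 i) / ln 2).

Definition ptraceA {a b} (s : 'M[C]_(a * b)) : 'M[C]_b :=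
  \matrix_(p, q) \sum_(i < a) s (mxtens_index (i, p)) (mxtens_index (i, q)).
Definition ptraceB {a b} (s : 'M[C]_(a * b)) : 'M[C]_a :=
  \matrix_(p, q) \sum_(j < b) s (mxtens_index (p, j)) (mxtens_index (q, j)).

Definition mutual_info {a b} (s : 'M[C]_(a * b)) : R :=
  vN_entropy (ptraceB s) + vN_entropy (ptraceA s) - vN_entropy s.

Definition block_of {k n} (X : 'M[C]_(k * n)) (i j : 'I_k) : 'M[C]_n :=
  \matrix_(p, q) X (mxtens_index (i, p)) (mxtens_index (j, q)).
Definition id_tens {k n m} (Phi : 'M[C]_n -> 'M[C]_m) (X : 'M[C]_(k * n))
  : 'M[C]_(k * m) :=
  \matrix_(u, v) Phi (block_of X (mxtens_unindex u).1 (mxtens_unindex v).1)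
                     (mxtens_unindex u).2 (mxtens_unindex v).2.

Definition linear_map {n m} (Phi : 'M[C]_n -> 'M[C]_m) : Prop :=
  forall (c : C) (X Y : 'M[C]_n), Phi (c *: X + Y) = c *: Phi X + Phi Y.

Definition completely_positive {n m} (Phi : 'M[C]_n -> 'M[C]_m) : Prop :=
  forall k (X : 'M[C]_(k * n)), psd X -> psd (id_tens Phi X).

Definition trace_preserving {n m} (Phi : 'M[C]_n -> 'M[C]_m) : Prop :=
  forall X : 'M[C]_n, \tr (Phi X) = \tr X.

Definition channel {n m} (Phi : 'M[C]_n -> 'M[C]_m) : Prop :=
  [/\ linear_map Phi, completely_positive Phi & trace_preserving Phi].

Definition proj_vec {d} (Psi : 'cV[C]_d) : 'M[C]_d := Psi *m adjmx Psi.

Definition purification {r n} (Psi : 'cV[C]_(r * n)) (rho : 'M[C]_n) : Prop :=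
  (adjmx Psi *m Psi) 0 0 = 1 /\ ptraceA (proj_vec Psi) = rho.

Definition ent_fidelity {r n} (Psi : 'cV[C]_(r * n)) (M : 'M[C]_n -> 'M[C]_n) : C :=
  (adjmx Psi *m id_tens M (proj_vec Psi) *m Psi) 0 0.

End Quantum.

(* Main.v *)
(* Let V be a purification of rho^RQ' with environment E. Since RQ'E is pure,
   S(Q) - I(R:Q')/2 = I(R:E)/2, so I(R:E) <= 2 eps: the state rho^RE is close, in
   relative entropy, to rho^R (x) rho^E. By sqrt x >= 1 + (ln x)/2,
     f := tr (sqrt rho^RE sqrt (rho^R (x) rho^E)) >= 1 - (ln 2) I(R:E)/2
       >= 1 - (ln 2) eps.
   The state rho^RE is purified by Q', and rho^R (x) rho^E is purified by Psi
   tensored with a purification of rho^E; composing the partial isometries of the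
   two polar decompositions gives a contraction from Q' to QE' that maps the first
   purification onto the second with amplitude f. Tracing out E', and completing
   the contraction to a channel, yields the recovery, of fidelity at least
   f^2 >= 1 - 2 sqrt eps. *)

Require Import Defs.
From HB Require Import structures.
From mathcomp Require Import all_boot all_order all_algebra.
From mathcomp Require Import classical_sets reals sequences exp.
From mathcomp Require Import ring lra.
From mathcomp.real_closed Require Import complex mxtens.

Set Implicit Arguments.
Unset Strict Implicit.
Unset Printing Implicit Defensive.

Import Order.TTheory GRing.Theory Num.Theory.
Local Open Scope ring_scope.
Local Open Scope complex_scope.
Local Notation "A ^H" := (adjmx A) (at level 8, format "A ^H").

(** * Adjoints, positive matrices and spectral decompositions *)

Section Adjoint.
Variable R : realType.
Local Notation C := R[i].

Lemma adjmxE m n (A : 'M[C]_(m, n)) i j : A^H i j = (A j i)^*.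
Proof. by rewrite !mxE. Qed.

Lemma adjmxK m n (A : 'M[C]_(m, n)) : A^H^H = A.
Proof. by apply/matrixP => i j; rewrite !adjmxE conjcK. Qed.

Lemma adjmxM m n p (A : 'M[C]_(m, n)) (B : 'M[C]_(n, p)) :
  (A *m B)^H = B^H *m A^H.
Proof. by rewrite /adjmx map_mxM trmx_mul. Qed.

Lemma adjmxB m n (A B : 'M[C]_(m, n)) : (A - B)^H = A^H - B^H.
Proof. by rewrite /adjmx !raddfB. Qed.

Lemma adjmx1 n : (1%:M : 'M[C]_n)^H = 1%:M.
Proof. by rewrite /adjmx map_mx1 trmx1. Qed.

Lemma adjmx_sum n m (I : finType) (F : I -> 'M[C]_(n, m)) :
  (\sum_a F a)^H = \sum_a (F a)^H.
Proof. by rewrite /adjmx !raddf_sum. Qed.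

Lemma adjmx_tr m n (A : 'M[C]_(m, n)) : A^T^H = A^H^T.
Proof. by apply/matrixP => i j; rewrite !mxE. Qed.

Lemma adjmx_tens m n p q (A : 'M[C]_(m, n)) (B : 'M[C]_(p, q)) :
  (A *t B)^H = A^H *t B^H.
Proof. by rewrite /adjmx map_mxT trmx_tens. Qed.

Lemma unitarymxVP n (U : 'M[C]_n) : Defs.unitarymx U -> U^H *m U = 1%:M.
Proof. exact: mulmx1C. Qed.

Lemma psd_congr m n (A : 'M[C]_m) (B : 'M[C]_(m, n)) :
  psd A -> psd (B^H *m A *m B).
Proof.
move=> [hA pA]; split.
  by rewrite /Defs.hermitian !adjmxM adjmxK hA mulmxA.
by move=> v; have := pA (B *m v); rewrite adjmxM !mulmxA.
Qed.

Lemma psd_gram m n (B : 'M[C]_(m, n)) : psd (B^H *m B).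
Proof.
rewrite -[B^H]mulmx1; apply: psd_congr; split; first exact: adjmx1.
move=> v; rewrite mulmx1 mxE; apply: sumr_ge0 => i _.
by rewrite adjmxE mulrC mulcJ_ge0.
Qed.

Lemma psd_outer m n (B : 'M[C]_(m, n)) : psd (B *m B^H).
Proof. by rewrite -[X in X *m _]adjmxK; exact: psd_gram. Qed.

Lemma psd_sum n (I : finType) (F : I -> 'M[C]_n) :
  (forall a, psd (F a)) -> psd (\sum_a F a).
Proof.
move=> hF; split.
  by rewrite /Defs.hermitian adjmx_sum; apply: eq_bigr => a _; case: (hF a).
move=> v; rewrite mulmx_sumr mulmx_suml summxE.
by apply: sumr_ge0 => a _; case: (hF a).
Qed.

(** Spectra are kept as real-valued functions, so that roots, products and inverses of eigenvalues
    act pointwise. *)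
Definition rdiag n (d : 'I_n -> R) : 'M[C]_n := diag_mx (\row_i (d i)%:C).

Lemma rdiagE n (d : 'I_n -> R) i j : rdiag d i j = (d i)%:C *+ (i == j).
Proof. by rewrite !mxE. Qed.

Lemma eq_rdiag n (d d' : 'I_n -> R) : d =1 d' -> rdiag d = rdiag d'.
Proof. by move=> h; apply/matrixP => i j; rewrite !rdiagE h. Qed.

Lemma rdiagM n (d d' : 'I_n -> R) :
  rdiag d *m rdiag d' = rdiag (fun i => d i * d' i).
Proof.
apply/matrixP => i j; rewrite mul_diag_mx !mxE.
by case: eqP => _; rewrite ?mulr1n ?mulr0n ?mulr0 ?rmorphM.
Qed.

Lemma rdiag1 n : rdiag (fun _ : 'I_n => 1) = 1%:M.
Proof. by apply/matrixP => i j; rewrite rdiagE mxE. Qed.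

Lemma adj_rdiag n (d : 'I_n -> R) : (rdiag d)^H = rdiag d.
Proof.
apply/matrixP => i j; rewrite adjmxE !rdiagE eq_sym; case: eqP => [->|_].
  by rewrite !mulr1n conjc_real.
by rewrite !mulr0n conjc0.
Qed.

Lemma rdiag_tens m n (d : 'I_m -> R) (d' : 'I_n -> R) :
  rdiag d *t rdiag d' = rdiag (fun x : 'I_(m * n) =>
    d (mxtens_unindex x).1 * d' (mxtens_unindex x).2).
Proof.
apply/matrixP => x y; case: (mxtens_indexP x) => i j.
case: (mxtens_indexP y) => k l; rewrite tensmxE !rdiagE.
rewrite !mxtens_indexK (can_eq (@mxtens_indexK _ _)) xpair_eqE /=.
by case: (i == k); case: (j == l);
  rewrite /= ?mulr0n ?mulr1n ?mul0r ?mulr0 ?rmorphM.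
Qed.

Lemma unitarymx_tensr m n (U : 'M[C]_m) :
  Defs.unitarymx U -> Defs.unitarymx (U *t (1%:M : 'M[C]_n)).
Proof.
move=> hU; rewrite /Defs.unitarymx adjmx_tens tensmx_mul hU adjmx1 mulmx1.
by rewrite -!rdiag1 rdiag_tens; apply: eq_rdiag => x; rewrite mulr1.
Qed.

Lemma spectral_decompP n (A : 'M[C]_n) (lam : 'rV[R]_n) :
  spectral_decomp A lam <->
  exists U, Defs.unitarymx U /\ A = U *m rdiag (lam 0) *m U^H.
Proof.
have E : diag_mx (map_mx (fun x : R => x%:C) lam) = rdiag (lam 0).
  by apply/matrixP => i j; rewrite !mxE.
by rewrite /spectral_decomp E.
Qed.

Lemma hermitian_spectral n (A : 'M[C]_n) :
  Defs.hermitian A -> exists lam, spectral_decomp A lam.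
Proof.
move=> hA.
have adjE p q (B : 'M[C]_(p, q)) : B^H = map_mx Num.conj B^T.
  by apply/matrixP => i j; rewrite adjmxE !mxE.
have hs : A \is hermsymmx.
  by apply/is_hermitianmxP; rewrite expr0 scale1r -adjE hA.
have /orthomx_spectralP eqA := hermitian_normalmx hs.
have realD := hermitian_spectral_diag_real hs.
have hU := spectral_unitarymx A.
move: (spectral_diag A) (spectralmx A) realD hU eqA => D P realD hU eqA.
have invP : invmx P = P^H by rewrite (invmx_unitary hU) adjE.
(* The spectral diagonal of a Hermitian matrix is real, so real parts lose nothing. The library form
   is [invmx P *m D *m P], hence the unitary is [P^H]. *)
exists (\row_i complex.Re (D 0 i)).
apply/spectral_decompP; exists P^H; split.
  rewrite /Defs.unitarymx adjmxK.
  by apply: mulmx1C; rewrite adjE; apply/unitarymxP.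
rewrite adjmxK eqA invP; congr (_ *m _ *m _).
apply/matrixP => i j; rewrite rdiagE !mxE; congr (_ *+ _).
by rewrite RRe_real //; move/mxOverP: realD; apply.
Qed.

Lemma psd_diag_ge0 n (A : 'M[C]_n) i : psd A -> 0 <= A i i.
Proof.
move=> [_ pA]; have := pA (delta_mx i 0).
have -> : (delta_mx i 0 : 'cV[C]_n)^H = delta_mx 0 i.
  by rewrite /adjmx map_delta_mx trmx_delta.
by rewrite -rowE -colE !mxE.
Qed.

Lemma spectral_ge0 n (A : 'M[C]_n) (lam : 'rV[R]_n) i :
  psd A -> spectral_decomp A lam -> 0 <= lam 0 i.
Proof.
move=> pA /spectral_decompP[U [/unitarymxVP UVU eqA]].
have := psd_diag_ge0 i (psd_congr U pA).
rewrite eqA !mulmxA UVU mul1mx -mulmxA UVU mulmx1 rdiagE eqxx mulr1n.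
by rewrite ler0c.
Qed.

End Adjoint.

(** * Entropy *)

Section Entropy.
Variable R : realType.
Local Notation C := R[i].

Definition sqmod (z : C) : R := complex.Re z ^+ 2 + complex.Im z ^+ 2.

Lemma sqmodE z : (sqmod z)%:C = z * conjc z.
Proof. by rewrite /sqmod add_Re2_Im2 sqr_normc. Qed.

Lemma sqmod_ge0 z : 0 <= sqmod z.
Proof. by rewrite addr_ge0 // sqr_ge0. Qed.

Lemma sqmod_row m n (W : 'M[C]_(m, n)) i :
  (W *m W^H) i i = (\sum_j sqmod (W i j))%:C.
Proof.
by rewrite mxE rmorph_sum; apply: eq_bigr => j _; rewrite adjmxE /= sqmodE.
Qed.

(* The singular vectors intertwine: [W = U^H X V] satisfies
   [lam i * W i j = W i j * mu j], so only matching eigenvalues meet. *)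
Lemma sum_spectral_gram m n (X : 'M[C]_(m, n)) lam mu (g : R -> R) :
  spectral_decomp (X *m X^H) lam -> spectral_decomp (X^H *m X) mu ->
  \sum_i lam 0 i * g (lam 0 i) = \sum_j mu 0 j * g (mu 0 j).
Proof.
move=> /spectral_decompP[U [hU eqU]] /spectral_decompP[V [hV eqV]].
have UVU := unitarymxVP hU; have VVV := unitarymxVP hV.
pose W := U^H *m X *m V.
have WW : W *m W^H = rdiag (lam 0).
  rewrite /W !adjmxM adjmxK !mulmxA -[_ *m V *m V^H]mulmxA hV mulmx1.
  rewrite -[U^H *m X *m X^H]mulmxA eqU !mulmxA UVU mul1mx.
  by rewrite -mulmxA UVU mulmx1.
have WVW : W^H *m W = rdiag (mu 0).
  rewrite /W !adjmxM adjmxK !mulmxA -[_ *m U *m U^H]mulmxA hU mulmx1.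
  rewrite -[V^H *m X^H *m X]mulmxA eqV !mulmxA VVV mul1mx.
  by rewrite -mulmxA VVV mulmx1.
clearbody W.
(* The squared moduli of [W] have row sums [lam] and column sums [mu], so both sides become double
   sums over the entries of [W]. *)
have lamE i : lam 0 i = \sum_j sqmod (W i j).
  apply: complexI; rewrite -sqmod_row WW rdiagE eqxx mulr1n //.
have muE j : mu 0 j = \sum_i sqmod (W i j).
  apply: complexI; have := sqmod_row W^H j.
  rewrite adjmxK WVW rdiagE eqxx mulr1n => ->; congr _%:C.
  by apply: eq_bigr => i _; apply: complexI; rewrite !sqmodE !adjmxE conjcK mulrC.
have inter i j : sqmod (W i j) * g (lam 0 i) = sqmod (W i j) * g (mu 0 j).
  have /matrixP/(_ i j) : rdiag (lam 0) *m W = W *m rdiag (mu 0).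
    by rewrite -WW -WVW mulmxA.
  rewrite mul_diag_mx mul_mx_diag !mxE mulrC => eqW.
  have [W0|W0] := eqVneq (W i j) 0.
    by rewrite W0 /sqmod /= !expr0n addr0 !mul0r.
  by congr (_ * g _); apply: complexI; apply: (mulfI W0).
transitivity (\sum_i \sum_j sqmod (W i j) * g (lam 0 i)).
  by apply: eq_bigr => i _; rewrite {1}lamE mulr_suml.
rewrite exchange_big; apply: eq_bigr => j _; rewrite {1}muE mulr_suml.
by apply: eq_bigr => i _; exact: inter.
Qed.

(** Negative entropy in nats; dividing by [ln 2] converts it to bits. *)
Definition hsum n (d : 'I_n -> R) : R := \sum_i d i * ln (d i).

Lemma eigvalsP n (A : 'M[C]_n) : psd A -> spectral_decomp A (eigvals A).
Proof. by case=> /hermitian_spectral exlam _; exact: xgetPex. Qed.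

Lemma mxtrace_spectral n (U : 'M[C]_n) (d : 'I_n -> R) :
  Defs.unitarymx U -> \tr (U *m rdiag d *m U^H) = (\sum_i d i)%:C.
Proof.
move=> hU; rewrite mxtrace_mulC mulmxA unitarymxVP // mul1mx mxtrace_diag.
by rewrite rmorph_sum; apply: eq_bigr => i _; rewrite mxE.
Qed.

Lemma psd_spectral n (A : 'M[C]_n) : psd A ->
  exists U (d : 'I_n -> R), [/\ Defs.unitarymx U, forall i, 0 <= d i &
    A = U *m rdiag d *m U^H].
Proof.
move=> pA; have eigA := eigvalsP pA.
have /spectral_decompP[U [hU eqA]] := eigA.
by exists U, (eigvals A 0); split=> // i; exact: spectral_ge0 pA eigA.
Qed.

(** The two products share their nonzero spectrum, and zero eigenvalues contribute nothing. Up to a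
    transpose, this is the equality of the marginal entropies of a pure state. *)
Lemma vN_entropy_gramC m n (X : 'M[C]_(m, n)) :
  vN_entropy (X *m X^H) = vN_entropy (X^H *m X).
Proof.
have h1 := eigvalsP (psd_gram X); have h2 := eigvalsP (psd_outer X).
congr (- _).
exact: (sum_spectral_gram (fun x => ln x / ln 2) h2 h1).
Qed.

Lemma psd_sqrt n (A : 'M[C]_n) (U : 'M[C]_n) (lam : 'I_n -> R) :
  (forall i, 0 <= lam i) -> A = U *m rdiag lam *m U^H ->
  A = (U *m rdiag (fun i => Num.sqrt (lam i))) *m
      (U *m rdiag (fun i => Num.sqrt (lam i)))^H.
Proof.
move=> lam0 ->; rewrite adjmxM adj_rdiag !mulmxA; congr (_ *m _).
rewrite -mulmxA rdiagM; congr (_ *m _); apply: eq_rdiag => i.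
by rewrite -expr2 sqr_sqrtr.
Qed.

Lemma psd_factor n (A : 'M[C]_n) : psd A -> exists Y : 'M_n, A = Y *m Y^H.
Proof.
by move=> /psd_spectral[U [d [_ d0 /(psd_sqrt d0) eqA]]]; eexists; exact: eqA.
Qed.

Lemma psd_tr n (A : 'M[C]_n) : psd A -> psd A^T.
Proof.
move=> /psd_factor[Y ->]; have := psd_outer (Y^H)^T.
by rewrite adjmx_tr adjmxK trmx_mul.
Qed.

(** Since [eigvals] is an arbitrary choice, independence of the decomposition must be shown: for
    [X = U sqrt(lam)] the matrix [X^H X] is diagonal with entries [lam], and [sum_spectral_gram]
    compares it with [A = X X^H]. *)
Lemma vN_entropyE n (A U : 'M[C]_n) (lam : 'I_n -> R) :
  (forall i, 0 <= lam i) -> Defs.unitarymx U -> A = U *m rdiag lam *m U^H ->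
  vN_entropy A = - (hsum lam / ln 2).
Proof.
move=> lam0 hU eqA; pose s i := Num.sqrt (lam i).
pose X := U *m rdiag s.
have eqX : A = X *m X^H by exact: psd_sqrt.
have h : spectral_decomp (X^H *m X) (\row_i lam i).
  apply/spectral_decompP; exists 1%:M; rewrite /Defs.unitarymx adjmx1 mulmx1.
  split=> //; rewrite mul1mx mulmx1 adjmxM adj_rdiag.
  rewrite mulmxA -[_ *m U^H *m U]mulmxA unitarymxVP // mulmx1 rdiagM.
  by apply: eq_rdiag => i; rewrite mxE -expr2 sqr_sqrtr.
have pA := psd_outer X.
rewrite /vN_entropy eqX.
rewrite (sum_spectral_gram (fun x => ln x / ln 2) (eigvalsP pA) h) /hsum mulr_suml.
by congr (- _); apply: eq_bigr => i _; rewrite mxE mulrA.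
Qed.

Lemma vN_entropy_tr n (A : 'M[C]_n) : psd A -> vN_entropy A^T = vN_entropy A.
Proof.
move=> /psd_spectral[U [lam [hU lam0 eqA]]].
have trU : U^T = (U^H)^T^H by rewrite adjmx_tr adjmxK.
rewrite (vN_entropyE lam0 hU eqA); apply: (@vN_entropyE _ _ (U^H)^T) => //.
  by rewrite /Defs.unitarymx -[RHS]trmx1 -[in RHS]hU trmx_mul -trU.
by rewrite -trU [in LHS]eqA !trmx_mul mulmxA tr_diag_mx.
Qed.

End Entropy.

(** * Channels and Kraus operators *)

Lemma sum_mxtens (V : nmodType) a b (F : 'I_(a * b) -> V) :
  \sum_k F k = \sum_i \sum_j F (mxtens_index (i, j)).
Proof.
rewrite pair_bigA /= (reindex (@mxtens_index a b)) /=.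
  by apply: eq_bigr => -[].
by exists (@mxtens_unindex a b) => k _; rewrite ?mxtens_indexK ?mxtens_unindexK.
Qed.

Section Channels.
Variable R : realType.
Local Notation C := R[i].

Lemma tens1mxE k n p q (K : 'M[C]_(n, p)) (Y : 'M[C]_(k * p, q)) i j y :
  ((1%:M *t K) *m Y) (mxtens_index (i, j)) y =
  \sum_l K j l * Y (mxtens_index (i, l)) y.
Proof.
rewrite mxE sum_mxtens (bigD1 i) //= [X in _ + X]big1 ?addr0.
  by apply: eq_bigr => l _; rewrite tensmxE mxE eqxx mul1r.
move=> i' ne; apply: big1 => l _; rewrite tensmxE mxE eq_sym (negbTE ne).
by rewrite !mul0r.
Qed.

Lemma id_tensE k n m (Phi : 'M[C]_n -> 'M[C]_m) (X : 'M[C]_(k * n)) i p j q :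
  id_tens Phi X (mxtens_index (i, p)) (mxtens_index (j, q)) =
  Phi (block_of X i j) p q.
Proof. by rewrite mxE !mxtens_indexK. Qed.

Lemma id_tens_comp k n m l (Phi : 'M[C]_n -> 'M[C]_m) (Phi' : 'M[C]_m -> 'M[C]_l)
    (X : 'M[C]_(k * n)) :
  id_tens (fun Y => Phi' (Phi Y)) X = id_tens Phi' (id_tens Phi X).
Proof.
apply/matrixP => u v; case: (mxtens_indexP u) => i p.
case: (mxtens_indexP v) => j q; rewrite !id_tensE; congr (Phi' _ p q).
by apply/matrixP => x y; rewrite mxE id_tensE.
Qed.

Lemma ptraceB_id_tens k n m (Phi : 'M[C]_n -> 'M[C]_m) (X : 'M[C]_(k * n)) :
  trace_preserving Phi -> ptraceB (id_tens Phi X) = ptraceB X.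
Proof.
move=> tpPhi; apply/matrixP => i j; rewrite !mxE.
transitivity (\tr (Phi (block_of X i j))).
  by apply: eq_bigr => p _; rewrite id_tensE.
by rewrite tpPhi; apply: eq_bigr => p _; rewrite mxE.
Qed.

Lemma mxtrace_ptraceB a b (X : 'M[C]_(a * b)) : \tr (ptraceB X) = \tr X.
Proof. by rewrite /mxtrace sum_mxtens; apply: eq_bigr => i _; rewrite mxE. Qed.

Lemma is_state_id_tens k n m (Phi : 'M[C]_n -> 'M[C]_m) (X : 'M[C]_(k * n)) :
  channel Phi -> is_state X -> is_state (id_tens Phi X).
Proof.
move=> [_ cpPhi tpPhi] [pX tX]; split; first exact: cpPhi.
by rewrite -mxtrace_ptraceB ptraceB_id_tens // mxtrace_ptraceB.
Qed.

Definition kraus (I : finType) n m (K : I -> 'M[C]_(m, n)) (X : 'M[C]_n) :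
  'M[C]_m := \sum_a K a *m X *m (K a)^H.

Lemma id_tens_kraus (I : finType) k n m (K : I -> 'M[C]_(m, n))
    (X : 'M[C]_(k * n)) :
  id_tens (kraus K) X = \sum_a (1%:M *t K a) *m X *m (1%:M *t K a)^H.
Proof.
apply/matrixP => u v; case: (mxtens_indexP u) => i p.
case: (mxtens_indexP v) => j q; rewrite id_tensE !summxE.
apply: eq_bigr => a _.
have -> : ((1%:M *t K a) *m X *m (1%:M *t K a)^H)
    (mxtens_index (i, p)) (mxtens_index (j, q)) =
    \sum_l conjc (K a q l) *
      ((1%:M *t K a) *m X) (mxtens_index (i, p)) (mxtens_index (j, l)).
  set Z := _ *m X; set T := 1%:M *t K a.
  have -> : Z *m T^H = (T *m Z^H)^H by rewrite adjmxM adjmxK.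
  rewrite adjmxE tens1mxE rmorph_sum; apply: eq_bigr => l _.
  by rewrite rmorphM adjmxE /= conjcK.
rewrite mxE; apply: eq_bigr => l _.
rewrite adjmxE mulrC tens1mxE; congr (_ * _); rewrite mxE.
by apply: eq_bigr => l' _; rewrite mxE.
Qed.

Lemma channel_kraus (I : finType) n m (K : I -> 'M[C]_(m, n)) :
  \sum_a (K a)^H *m K a = 1%:M -> channel (kraus K).
Proof.
move=> sumK; split.
- move=> c X Y; rewrite /kraus scaler_sumr -big_split; apply: eq_bigr => a _.
  by rewrite mulmxDr mulmxDl -scalemxAr -scalemxAl.
- move=> k X pX; rewrite id_tens_kraus; apply: psd_sum => a.
  by rewrite -[X in X *m _ *m _]adjmxK; exact: psd_congr.
move=> X; rewrite /kraus raddf_sum -[X in RHS]mul1mx -sumK mulmx_suml raddf_sum.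
by apply: eq_bigr => a _ /=; rewrite mxtrace_mulC mulmxA.
Qed.

(** The columns of [V] are unnormalised pure components of the channel output, so the fidelity
    collects one squared amplitude per Kraus operator and per component. *)
Lemma ent_fidelity_kraus (I : finType) n m N (Psi : 'cV[C]_(n * n))
    (Phi : 'M[C]_n -> 'M[C]_m) (K : I -> 'M[C]_(n, m)) (V : 'M[C]_(n * m, N)) :
  id_tens Phi (proj_vec Psi) = V *m V^H ->
  ent_fidelity Psi (fun X => kraus K (Phi X)) =
  (\sum_a \sum_e sqmod ((Psi^H *m (1%:M *t K a) *m V) 0 e))%:C.
Proof.
move=> eqV; rewrite /ent_fidelity id_tens_comp eqV id_tens_kraus.
rewrite mulmx_sumr mulmx_suml summxE rmorph_sum; apply: eq_bigr => a _.
rewrite /= -sqmod_row !adjmxM !adjmxK !mulmxA //.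
Qed.

End Channels.

(** * Overlap of a bipartite state with the product of its marginals *)

Section Overlap.
Variable R : realType.
Local Notation C := R[i].

Lemma sqrt_expR (x : R) : 0 < x -> Num.sqrt x = expR (ln x / 2).
Proof.
move=> x0; rewrite -{1}[x](lnK (x := x)) ?posrE // {1}[ln x]splitr expRD.
by rewrite -expr2 sqrtr_sqr ger0_norm // expR_ge0.
Qed.

(* [sqrt (q / p) >= 1 + ln (q / p) / 2] makes the relative entropy linear in
   the overlap. *)
Lemma sum_sqrt_overlap_ge (I J : finType) (p : I -> R) (q : J -> R)
    (w : I -> J -> R) :
  (forall i, 0 <= p i) -> (forall i j, 0 <= w i j) ->
  (forall i, \sum_j w i j = 1) -> \sum_i p i = 1 ->
  (forall i j, p i * w i j != 0 -> 0 < q j) ->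
  1 + (\sum_i \sum_j p i * w i j * (ln (q j) - ln (p i))) / 2 <=
  \sum_i \sum_j Num.sqrt (p i) * Num.sqrt (q j) * w i j.
Proof.
move=> p0 w0 w1 p1 q0; rewrite mulr_suml -{1}p1 -big_split /=.
apply: ler_sum => i _.
have {1}-> : p i = \sum_j p i * w i j by rewrite -mulr_sumr w1 mulr1.
rewrite mulr_suml.
rewrite -big_split /=; apply: ler_sum => j _.
have [z|nz] := eqVneq (p i * w i j) 0.
  by rewrite z !mul0r addr0 !mulr_ge0 ?sqrtr_ge0.
have qj := q0 _ _ nz.
have pi0 : 0 < p i.
  by rewrite lt0r p0 andbT; apply: contraNneq nz => ->; rewrite mul0r.
have -> : Num.sqrt (p i) * Num.sqrt (q j) =
    p i * expR ((ln (q j) - ln (p i)) / 2).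
  rewrite !sqrt_expR // -{2}[p i]lnK ?posrE // -!expRD; congr expR.
  by field.
rewrite [leRHS]mulrAC -[X in _ + X]mulrA -[X in X + _]mulr1 -mulrDr.
rewrite ler_wpM2l ?mulr_ge0 //.
exact: expR_ge1Dx.
Qed.

Lemma sum_spectral_row n (U V : 'M[C]_n) k : Defs.unitarymx U ->
  Defs.unitarymx V -> \sum_x sqmod ((U^H *m V) k x) = 1.
Proof.
move=> hU hV; apply: complexI; rewrite -sqmod_row adjmxM adjmxK mulmxA.
by rewrite -[_ *m V *m V^H]mulmxA hV mulmx1 unitarymxVP // mxE eqxx.
Qed.

Lemma tensr1mxE a b q (A : 'M[C]_a) (Z : 'M[C]_(q, a * b)) y i j :
  (Z *m (A *t 1%:M)) y (mxtens_index (i, j)) =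
  \sum_l Z y (mxtens_index (l, j)) * A l i.
Proof.
rewrite mxE sum_mxtens; apply: eq_bigr => l _.
rewrite (bigD1 j) //= [X in _ + X]big1 ?addr0.
  by rewrite tensmxE mxE eqxx mulr1.
by move=> j' ne; rewrite tensmxE mxE (negbTE ne) !mulr0.
Qed.

Lemma tensl1mxE a b q (A : 'M[C]_a) (Z : 'M[C]_(a * b, q)) y i j :
  ((A *t 1%:M) *m Z) (mxtens_index (i, j)) y =
  \sum_l A i l * Z (mxtens_index (l, j)) y.
Proof.
rewrite mxE sum_mxtens; apply: eq_bigr => l _.
rewrite (bigD1 j) //= [X in _ + X]big1 ?addr0.
  by rewrite tensmxE mxE eqxx mulr1.
by move=> j' ne; rewrite tensmxE mxE eq_sym (negbTE ne) mulr0 mul0r.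
Qed.

Lemma ptraceB_mull a b (A : 'M[C]_a) (Z : 'M[C]_(a * b)) :
  ptraceB ((A *t 1%:M) *m Z) = A *m ptraceB Z.
Proof.
apply/matrixP => i j; rewrite !mxE.
under eq_bigr do rewrite tensl1mxE.
rewrite exchange_big; apply: eq_bigr => l _.
by rewrite mxE mulr_sumr.
Qed.

Lemma ptraceB_mulr a b (A : 'M[C]_a) (Z : 'M[C]_(a * b)) :
  ptraceB (Z *m (A *t 1%:M)) = ptraceB Z *m A.
Proof.
apply/matrixP => i j; rewrite !mxE.
under eq_bigr do rewrite tensr1mxE.
rewrite exchange_big; apply: eq_bigr => l _.
by rewrite mxE mulr_suml.
Qed.

(** A partial trace is cyclic for operators acting on the factor traced out. *)
Lemma ptraceA_mulC a b (A : 'M[C]_a) (Z : 'M[C]_(a * b)) :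
  ptraceA ((A *t 1%:M) *m Z) = ptraceA (Z *m (A *t 1%:M)).
Proof.
apply/matrixP => i j; rewrite !mxE.
under eq_bigr do rewrite tensl1mxE.
under [RHS]eq_bigr do rewrite tensr1mxE.
rewrite exchange_big; apply: eq_bigr => l _.
by apply: eq_bigr => k _; rewrite mulrC.
Qed.

(* The left-hand side is [1 - D / 2] for the relative entropy [D], in nats, of
   the state with respect to the product of its marginals. *)
Lemma overlap_marginals_ge a b (K : 'M[C]_(a * b)) (A : 'M[C]_a)
    (p : 'I_(a * b) -> R) (r : 'I_a -> R) (lam : 'I_b -> R)
    (rho := K *m rdiag p *m K^H) :
  Defs.unitarymx K -> Defs.unitarymx A ->
  (forall k, 0 <= p k) -> (forall i, 0 <= r i) -> (forall e, 0 <= lam e) ->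
  \sum_k p k = 1 -> ptraceB rho = A *m rdiag r *m A^H ->
  ptraceA rho = rdiag lam ->
  1 + (hsum r + hsum lam - hsum p) / 2 <=
  \sum_k \sum_x Num.sqrt (p k) *
    Num.sqrt (r (mxtens_unindex x).1 * lam (mxtens_unindex x).2) *
    sqmod ((K^H *m (A *t 1%:M)) k x).
Proof.
move=> hK hA p0 r0 lam0 p1 hB hAl.
set L : 'M_(a * b) := A *t 1%:M.
(* Transition probabilities from the eigenbasis of [rho] to the product eigenbasis [L] of its
   marginals; [d] below is the diagonal of [rho] in that basis, a joint distribution with marginals
   [r] and [lam]. *)
pose w k x := sqmod ((K^H *m L) k x).
have hL : Defs.unitarymx L by exact: unitarymx_tensr.
pose d x := \sum_k p k * w k x.
have dE x : (d x)%:C = (L^H *m rho *m L) x x.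
  have -> : L^H *m rho *m L = (K^H *m L)^H *m rdiag p *m (K^H *m L).
    by rewrite /rho adjmxM adjmxK !mulmxA.
  rewrite /d /w; move: (K^H *m L) => W.
  rewrite mxE rmorph_sum; apply: eq_bigr => k _.
  by rewrite mul_mx_diag rmorphM /= sqmodE !mxE mulrA mulrC mulrA.
have LH : L^H = A^H *t 1%:M by rewrite adjmx_tens adjmx1.
have dr i : \sum_e d (mxtens_index (i, e)) = r i.
  apply: complexI; rewrite rmorph_sum.
  transitivity (ptraceB (L^H *m rho *m L) i i).
    by rewrite mxE; apply: eq_bigr => e _; rewrite -dE.
  rewrite ptraceB_mulr LH ptraceB_mull hB !mulmxA unitarymxVP // mul1mx.
  by rewrite -mulmxA unitarymxVP // mulmx1 rdiagE eqxx.
have dl e : \sum_i d (mxtens_index (i, e)) = lam e.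
  apply: complexI; rewrite rmorph_sum.
  transitivity (ptraceA (L^H *m rho *m L) e e).
    by rewrite mxE; apply: eq_bigr => i _; rewrite -dE.
  rewrite LH -mulmxA ptraceA_mulC -LH -mulmxA hL mulmx1.
  by rewrite hAl rdiagE eqxx.
have w0 k x : 0 <= w k x by exact: sqmod_ge0.
have d0 x : 0 <= d x by apply: sumr_ge0 => k _; rewrite mulr_ge0.
(* Support inclusion: logarithms of [r] and [lam] are taken at positive numbers wherever they carry
   weight. *)
have pos i e : d (mxtens_index (i, e)) != 0 -> 0 < r i /\ 0 < lam e.
  move=> nz; have dpos : 0 < d (mxtens_index (i, e)) by rewrite lt0r nz d0.
  rewrite -dr -dl (bigD1 e) //= [X in _ /\ 0 < X](bigD1 i) //=.
  by split; apply: ltr_wpDr => //; apply: sumr_ge0.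
have w1 k : \sum_x w k x = 1 by exact: sum_spectral_row.
pose q x := r (mxtens_unindex x).1 * lam (mxtens_unindex x).2.
have pwd k x : p k * w k x != 0 -> d x != 0.
  move=> nz; rewrite gt_eqF // /d (bigD1 k) //= ltr_wpDr //.
    by apply: sumr_ge0 => k' _; rewrite mulr_ge0.
  by rewrite lt0r nz mulr_ge0.
apply: le_trans (sum_sqrt_overlap_ge (q := q) p0 w0 w1 p1 _); last first.
  move=> k x /pwd; case: (mxtens_indexP x) => i e /pos[ri le].
  by rewrite /q mxtens_indexK mulr_gt0.
rewrite lerD2l ler_pM2r ?invr_gt0 ?ltr0n //.
under eq_bigr do under eq_bigr do rewrite mulrBr.
under eq_bigr do rewrite sumrB.
rewrite sumrB lerB //; last first.
  rewrite /hsum le_eqVlt; apply/orP; left; apply/eqP/eq_bigr => k _.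
  by rewrite -mulr_suml -mulr_sumr w1 mulr1.
rewrite exchange_big /= sum_mxtens /hsum.
under [X in _ <= X]eq_bigr do under eq_bigr do rewrite -mulr_suml -/(d _).
rewrite le_eqVlt; apply/orP; left; apply/eqP.
transitivity (\sum_i \sum_e (d (mxtens_index (i, e)) * ln (r i) +
    d (mxtens_index (i, e)) * ln (lam e))).
  under [RHS]eq_bigr do rewrite big_split /=.
  rewrite big_split /=; congr (_ + _).
    by apply: eq_bigr => i _; rewrite -mulr_suml dr.
  rewrite exchange_big; apply: eq_bigr => e _.
  by rewrite -mulr_suml dl.
apply: eq_bigr => i _; apply: eq_bigr => e _.
have [->|/pos[ri le]] := eqVneq (d (mxtens_index (i, e))) 0.
  by rewrite !mul0r addr0.
by rewrite /q mxtens_indexK lnM ?posrE // mulrDr.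
Qed.

End Overlap.

(** * The recovery contraction *)

Section Recovery.
Variable R : realType.
Local Notation C := R[i].

Definition partial_isometry s t (U : 'M[C]_(s, t)) := U *m U^H *m U = U.

Lemma psdD n (A B : 'M[C]_n) : psd A -> psd B -> psd (A + B).
Proof.
move=> [hA pA] [hB pB]; split.
  by rewrite /Defs.hermitian -[in RHS]hA -[in RHS]hB /adjmx !raddfD.
by move=> v; rewrite mulmxDr mulmxDl mxE addr_ge0.
Qed.

(** The witness is [(M M^H)^(-1/2) M], with the inverse root taken on the support. *)
Lemma polar_partial_isometry s t (M : 'M[C]_(s, t)) (K : 'M[C]_s)
    (p : 'I_s -> R) :
  Defs.unitarymx K -> (forall k, 0 <= p k) -> M *m M^H = K *m rdiag p *m K^H ->
  exists2 U, partial_isometry U &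
    M *m U^H = K *m rdiag (fun k => Num.sqrt (p k)) *m K^H.
Proof.
(* As [0^-1 = 0], [T] is the pseudo-inverse of the square root of [M M^H]. *)
move=> hK p0 eqM; have [T TE] :
    {T | T = K *m rdiag (fun k => (Num.sqrt (p k))^-1) *m K^H} by eexists.
have TH : T^H = T by rewrite TE !adjmxM adjmxK adj_rdiag mulmxA.
have KV := unitarymxVP hK.
have diagM f g : (K *m rdiag f *m K^H) *m (K *m rdiag g *m K^H) =
    K *m rdiag (fun k => f k * g k) *m K^H.
  rewrite !mulmxA -[_ *m K^H *m K]mulmxA KV mulmx1.
  by rewrite -[_ *m rdiag f *m rdiag g]mulmxA rdiagM.
have pp k : p k = Num.sqrt (p k) * Num.sqrt (p k) by rewrite -expr2 sqr_sqrtr.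
exists (T *m M); last first.
  rewrite adjmxM TH mulmxA eqM TE diagM; congr (_ *m _ *m _).
  apply: eq_rdiag => k; rewrite {1}pp.
  have [->|nz] := eqVneq (Num.sqrt (p k)) 0; first by rewrite !mul0r.
  by rewrite mulfK.
rewrite /partial_isometry adjmxM TH !mulmxA -[T *m M *m M^H]mulmxA eqM.
rewrite TE !diagM; congr (_ *m M); congr (_ *m K^H); congr (K *m _).
apply: eq_rdiag => k.
rewrite {2}pp; have [->|nz] := eqVneq (Num.sqrt (p k)) 0.
  by rewrite invr0 !mulr0.
by rewrite mulKf // divff // mul1r.
Qed.

(** With the projections [Q = U^H U] and [Pi = V V^H], the difference equals
    [(1 - Q) + U^H (1 - Pi) U], a sum of two Gram matrices. *)
Lemma partial_isometry_contraction s t l (U : 'M[C]_(s, t)) (V : 'M[C]_(s, l)) :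
  partial_isometry U -> partial_isometry V ->
  psd (1%:M - (U^H *m V) *m (U^H *m V)^H).
Proof.
move=> hU hV; pose Q := U^H *m U; pose Pi := V *m V^H.
have QH : Q^H = Q by rewrite /Q adjmxM adjmxK.
have PiH : Pi^H = Pi by rewrite /Pi adjmxM adjmxK.
have QQ : Q *m Q = Q by rewrite /Q -mulmxA [U *m _]mulmxA hU.
have PiPi : Pi *m Pi = Pi by rewrite /Pi mulmxA hV.
have -> : 1%:M - (U^H *m V) *m (U^H *m V)^H =
    (1%:M - Q)^H *m (1%:M - Q) + ((1%:M - Pi) *m U)^H *m ((1%:M - Pi) *m U).
  have idem k (E : 'M[C]_k) : E^H = E -> E *m E = E ->
      (1%:M - E)^H *m (1%:M - E) = 1%:M - E.
    move=> EH EE; rewrite adjmxB adjmx1 EH mulmxBr mulmx1 mulmxBl mul1mx EE.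
    by rewrite subrr subr0.
  have -> : ((1%:M - Pi) *m U)^H *m ((1%:M - Pi) *m U) =
      U^H *m (1%:M - Pi) *m U.
    by rewrite adjmxM -mulmxA [_^H *m (_ *m U)]mulmxA idem // mulmxA.
  rewrite idem // mulmxBr mulmx1 mulmxBl addrA subrK adjmxM adjmxK /Pi.
  by rewrite !mulmxA.
by apply: psdD; exact: psd_gram.
Qed.

Lemma mxtrace_sqrt_overlap s (K L : 'M[C]_s) (p q : 'I_s -> R) :
  \tr ((K *m rdiag p *m K^H) *m (L *m rdiag q *m L^H)) =
  (\sum_k \sum_x p k * q x * sqmod ((K^H *m L) k x))%:C.
Proof.
rewrite -!mulmxA mxtrace_mulC !mulmxA.
have -> : rdiag p *m K^H *m L *m rdiag q *m L^H *m K =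
    rdiag p *m ((K^H *m L) *m rdiag q *m (K^H *m L)^H).
  by rewrite adjmxM adjmxK !mulmxA.
move: (K^H *m L) => W.
rewrite /mxtrace rmorph_sum; apply: eq_bigr => k _.
rewrite mul_diag_mx !mxE mulr_sumr rmorph_sum; apply: eq_bigr => x _.
rewrite mul_mx_diag !rmorphM /= sqmodE !mxE.
by rewrite [W k x * _]mulrC !mulrA.
Qed.

(* With the partial isometries [U], [V] of the polar decompositions of [M] and
   [N], the choice [G = U^H V] gives [tr (sqrt (M M^H) sqrt (N N^H))], which
   lower bounds the Uhlmann fidelity. *)
Lemma recovery_contraction s t l (M : 'M[C]_(s, t)) (N : 'M[C]_(s, l))
    (K L : 'M[C]_s) (p q : 'I_s -> R) :
  Defs.unitarymx K -> Defs.unitarymx L ->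
  (forall k, 0 <= p k) -> (forall x, 0 <= q x) ->
  M *m M^H = K *m rdiag p *m K^H -> N *m N^H = L *m rdiag q *m L^H ->
  exists2 G : 'M[C]_(t, l), psd (1%:M - G *m G^H) &
    \tr (M *m G *m N^H) =
    (\sum_k \sum_x Num.sqrt (p k) * Num.sqrt (q x) * sqmod ((K^H *m L) k x))%:C.
Proof.
move=> hK hL p0 q0 eqM eqN.
have [U pU MU] := polar_partial_isometry hK p0 eqM.
have [V pV NV] := polar_partial_isometry hL q0 eqN.
exists (U^H *m V); first exact: partial_isometry_contraction.
have VN : V *m N^H = L *m rdiag (fun x => Num.sqrt (q x)) *m L^H.
  by rewrite -[LHS]adjmxK adjmxM adjmxK NV !adjmxM adjmxK adj_rdiag mulmxA.
by rewrite mulmxA MU -mulmxA VN mxtrace_sqrt_overlap.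
Qed.

Lemma mul_delta_mx_sandwich n m (B : 'M[C]_n) (i : 'I_n) (j : 'I_m) :
  delta_mx j i *m B *m delta_mx i j = B i i *: delta_mx j j.
Proof.
rewrite -(mul_delta_mx (0 : 'I_1) j i) -(mul_delta_mx (0 : 'I_1) i j).
rewrite -!mulmxA [_ *m (B *m _)]mulmxA -rowE [row i B *m _]mulmxA -colE.
by rewrite [col _ _]mx11_scalar mul_scalar_mx -scalemxAr mul_delta_mx !mxE.
Qed.

(* The missing weight [1 - sum K^H K] is discarded into the state [S S^H]. *)
Lemma complete_kraus (I : finType) n m (K : I -> 'M[C]_(n, m)) (S : 'M[C]_n) :
  \tr (S^H *m S) = 1 -> psd (1%:M - \sum_a (K a)^H *m K a) ->
  exists2 K' : I + 'I_n * 'I_m -> 'M[C]_(n, m),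
    forall a, K' (inl a) = K a & \sum_a (K' a)^H *m K' a = 1%:M.
Proof.
move=> trS /psd_factor[Y eqY].
(* If the missing weight is [Y Y^H], the added operators implement [X |-> tr (Y^H X Y) S S^H]. *)
exists (fun a => match a with
  | inl a => K a | inr ij => S *m delta_mx ij.1 ij.2 *m Y^H end) => //.
rewrite big_sumType /=; apply/eqP; rewrite eq_sym addrC -subr_eq eqY; apply/eqP.
transitivity (\sum_i \sum_j (S^H *m S) i i *: (Y *m delta_mx j j *m Y^H)).
  under eq_bigr do rewrite -scaler_sumr -mulmx_suml -mulmx_sumr.
  by rewrite -scaler_suml -/(\tr _) trS scale1r -mx1_sum_delta mulmx1.
rewrite pair_bigA; apply: eq_bigr => -[i j] _ /=.
have deltaH : (delta_mx i j : 'M[C]_(n, m))^H = delta_mx j i.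
  by rewrite /adjmx map_delta_mx trmx_delta.
rewrite scalemxAl scalemxAr -mul_delta_mx_sandwich.
by rewrite !adjmxM adjmxK deltaH !mulmxA.
Qed.

End Recovery.

(** * Purifications *)

Section Reshape.
Variable R : realType.
Local Notation C := R[i].

(** As a matrix, a bipartite vector has both reduced states as Gram products, the second one
    transposed. *)
Definition unvec a b (Psi : 'cV[C]_(a * b)) : 'M[C]_(a, b) :=
  \matrix_(i, j) Psi (mxtens_index (i, j)) 0.

Lemma proj_vecE d (Psi : 'cV[C]_d) x y :
  proj_vec Psi x y = Psi x 0 * conjc (Psi y 0).
Proof. by rewrite mxE big_ord1 adjmxE. Qed.

Lemma ptraceB_proj_vec a b (Psi : 'cV[C]_(a * b)) :
  ptraceB (proj_vec Psi) = unvec Psi *m (unvec Psi)^H.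
Proof.
apply/matrixP => i j; rewrite !mxE; apply: eq_bigr => k _.
by rewrite proj_vecE adjmxE !mxE.
Qed.

Lemma ptraceA_proj_vec a b (Psi : 'cV[C]_(a * b)) :
  ptraceA (proj_vec Psi) = ((unvec Psi)^H *m unvec Psi)^T.
Proof.
apply/matrixP => i j; rewrite !mxE; apply: eq_bigr => k _.
by rewrite proj_vecE adjmxE !mxE mulrC.
Qed.

(* The columns of [V] are vectors on A (x) B; they become the environment
   index, grouped with A. *)
Definition regroup a b c (V : 'M[C]_(a * b, c)) : 'M[C]_(a * c, b) :=
  \matrix_(x, j) V (mxtens_index ((mxtens_unindex x).1, j)) (mxtens_unindex x).2.

Lemma regroupE a b c (V : 'M[C]_(a * b, c)) i e j :
  regroup V (mxtens_index (i, e)) j = V (mxtens_index (i, j)) e.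
Proof. by rewrite mxE mxtens_indexK. Qed.

(** For the pure state on A, B and environment with components [V], this and the next two lemmas
    give the reduced states of A, of the environment and of B. *)
Lemma ptraceB_regroup a b c (V : 'M[C]_(a * b, c)) :
  ptraceB (regroup V *m (regroup V)^H) = ptraceB (V *m V^H).
Proof.
apply/matrixP => i j; rewrite !mxE.
under eq_bigr do rewrite mxE.
under [RHS]eq_bigr do rewrite mxE.
rewrite exchange_big; apply: eq_bigr => k _; apply: eq_bigr => e _.
by rewrite !adjmxE !regroupE.
Qed.

Lemma ptraceA_regroup a b c (V : 'M[C]_(a * b, c)) :
  ptraceA (regroup V *m (regroup V)^H) = (V^H *m V)^T.
Proof.
apply/matrixP => e f; rewrite !mxE sum_mxtens.
under eq_bigr do rewrite mxE.
apply: eq_bigr => i _; apply: eq_bigr => k _.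
by rewrite !adjmxE !regroupE mulrC.
Qed.

Lemma regroup_gram a b c (V : 'M[C]_(a * b, c)) :
  (regroup V)^H *m regroup V = (ptraceA (V *m V^H))^T.
Proof.
apply/matrixP => p q; rewrite !mxE sum_mxtens.
under [RHS]eq_bigr do rewrite mxE.
apply: eq_bigr => i _; apply: eq_bigr => k _.
by rewrite !adjmxE !regroupE mulrC.
Qed.

(* [G] read as an operator B -> A' (x) environment, cut into Kraus operators. *)
Definition slice m n N (G : 'M[C]_(m, n * N)) (e : 'I_N) : 'M[C]_(n, m) :=
  \matrix_(q, q') G q' (mxtens_index (q, e)).

(** Turns contractivity of [G] into the trace-nonincreasing condition on its Kraus slices. *)
Lemma slice_gram m n N (G : 'M[C]_(m, n * N)) :
  \sum_e (slice G e)^H *m slice G e = (G *m G^H)^T.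
Proof.
apply/matrixP => p q; rewrite summxE !mxE sum_mxtens exchange_big.
apply: eq_bigr => e _; rewrite mxE; apply: eq_bigr => i _.
by rewrite !adjmxE !mxE mulrC.
Qed.

(** The trace is the overlap of the state with components [V], after [G], with [Psi] tensored with
    the purification of weights [s]. That purification is diagonal, so only equal environment
    indices survive. *)
Lemma amplitude n m N (Psi : 'cV[C]_(n * n)) (V : 'M[C]_(n * m, N))
    (G : 'M[C]_(m, n * N)) (s : 'I_N -> R) :
  \tr (regroup V *m G *m (unvec Psi *t rdiag s)^H) =
  \sum_e (s e)%:C * (Psi^H *m (1%:M *t slice G e) *m V) 0 e.
Proof.
rewrite /mxtrace sum_mxtens exchange_big; apply: eq_bigr => e _.
rewrite -[in RHS]mulmxA [in RHS]mxE sum_mxtens mulr_sumr; apply: eq_bigr => i _.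
rewrite [LHS]mxE sum_mxtens mulr_sumr; apply: eq_bigr => q _.
rewrite (bigD1 e) //= [X in _ + X]big1 ?addr0; last first.
  move=> e' ne; rewrite adjmxE tensmxE rdiagE eq_sym (negbTE ne) mulr0.
  by rewrite conjc0 mulr0.
have conjMr (x : C) (y : R) : conjc (x * y%:C) = conjc x * y%:C.
  by rewrite rmorphM; congr (_ * _); exact: conjc_real.
rewrite !adjmxE tensmxE rdiagE eqxx mulr1n conjMr tens1mxE.
rewrite [unvec _ _ _]mxE.
have -> : (regroup V *m G) (mxtens_index (i, e)) (mxtens_index (q, e)) =
    \sum_l slice G e q l * V (mxtens_index (i, l)) e.
  by rewrite mxE; apply: eq_bigr => l _; rewrite regroupE !mxE mulrC.
by ring.
Qed.

End Reshape.

(** * Scalar inequalities *)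

Section Numeric.
Variable R : realType.
Local Notation C := R[i].

(** Cauchy-Schwarz against the unit vector [sqrt lam], obtained by expanding a nonnegative sum of
    squares. *)
Lemma sqr_le_sum_sqmod N (lam : 'I_N -> R) (c : 'I_N -> C) (f : R) :
  (forall e, 0 <= lam e) -> \sum_e lam e = 1 ->
  \sum_e (Num.sqrt (lam e))%:C * c e = f%:C -> f ^+ 2 <= \sum_e sqmod (c e).
Proof.
move=> lam0 lam1 /(congr1 (@complex.Re R)) /= eqf.
have {}eqf : \sum_e Num.sqrt (lam e) * complex.Re (c e) = f.
  rewrite -eqf raddf_sum; apply: eq_bigr => e _.
  by case: (c e) => x y /=; rewrite mul0r subr0.
have : 0 <= \sum_e (complex.Re (c e) - f * Num.sqrt (lam e)) ^+ 2.
  by apply: sumr_ge0 => e _; exact: sqr_ge0.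
rewrite (eq_bigr (fun e => complex.Re (c e) ^+ 2 +
    - (2 * f) * (Num.sqrt (lam e) * complex.Re (c e)) + f ^+ 2 * lam e));
  last by move=> e _; rewrite -{3}(sqr_sqrtr (lam0 e)); ring.
rewrite !big_split /= -!mulr_sumr eqf lam1.
move=> h; apply: (@le_trans _ _ (\sum_e complex.Re (c e) ^+ 2)); first by nra.
by rewrite lerDl sumr_ge0 // => e _; rewrite sqr_ge0.
Qed.

(** For [s = sqrt eps] in [0, 1], [f >= 1 - s^2] and [(1 - s^2)^2 - (1 - 2 s) = 2 s (1 - s) + s^4 >=
    0]. For [s > 1] the left side is negative; for [eps < 0] the root is 0 by convention and
    [f >= 1]. *)
Lemma sqr_ge_sqrt (t eps f : R) : 0 < t -> t <= 1 -> 0 <= f ->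
  1 - t * eps <= f -> 1 - 2 * Num.sqrt eps <= f ^+ 2.
Proof.
move=> t0 t1 f0 hf; have [e0|e0] := lerP 0 eps; last first.
  have te : t * eps < 0 by rewrite pmulr_rlt0.
  have f1 : 1 <= f by lra.
  by rewrite ltr0_sqrtr // mulr0 subr0 expr_ge1.
have s0 := sqrtr_ge0 eps; have := sqr_sqrtr e0; move: (Num.sqrt eps) s0 => s s0 es.
have {}hf : 1 - s ^+ 2 <= f by rewrite es; nra.
have [s1|s1] := lerP s 1; last by nra.
have : (1 - s ^+ 2) ^+ 2 <= f ^+ 2 by rewrite ler_sqr ?nnegrE //; nra.
by nra.
Qed.

Lemma ln2_bounds : 0 < ln (2 : R) /\ ln (2 : R) <= 1.
Proof.
split; first by rewrite ln_gt0 // ltr1n.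
by apply: (@le_ln1Dx R 1); lra.
Qed.

End Numeric.

(** * Construction of the recovery channel and its fidelity *)

Theorem theorem2 (R : realType)
  (Ebul : forall a b : nat, 'M[R[i]]_(a * b) -> R)
  (hE : forall a b (s : 'M[R[i]]_(a * b)),
      is_state s -> Ebul a b s <= mutual_info s / 2)
  (n m : nat) (rho : 'M[R[i]]_n) (hrho : is_state rho)
  (Ech : 'M[R[i]]_n -> 'M[R[i]]_m) (hEch : channel Ech)
  (Psi : 'cV[R[i]]_(n * n)) (hPsi : purification Psi rho) :
  let rhoRQ' : 'M[R[i]]_(n * m) := id_tens Ech (proj_vec Psi) in
  let eps := vN_entropy rho - Ebul n m rhoRQ' in
  exists Rch : 'M[R[i]]_m -> 'M[R[i]]_n,
    channel Rch /\
    (1 - 2 * Num.sqrt eps)%:C <= ent_fidelity Psi (fun X => Rch (Ech X)).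
Proof.
move=> rhoRQ' eps; case: hPsi => Psi1 ptPsi.
set P := unvec Psi.
have stPsi : is_state (proj_vec Psi).
  split; first by exact: psd_outer.
  by rewrite /proj_vec mxtrace_mulC /mxtrace big_ord1.
have [prq trq] : is_state rhoRQ' by exact: is_state_id_tens.
have tpE : trace_preserving Ech by case: hEch.
have ptB : ptraceB rhoRQ' = P *m P^H.
  by rewrite ptraceB_id_tens // ptraceB_proj_vec.
have trP : \tr (P^H *m P) = 1.
  by rewrite mxtrace_mulC -ptB mxtrace_ptraceB.
have pPP := psd_outer P.
have [A [r [hA r0 eqA]]] := psd_spectral pPP.
have [U [lam [hU lam0 eqU]]] := psd_spectral prq.
pose s e := Num.sqrt (lam e).
(* The columns of [V] are scaled eigenvectors: they purify [rhoRQ'] with an environment E whose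
   state is diagonal with entries [lam]. *)
have [V VE] : {V | V = U *m rdiag s} by eexists.
have eqV : rhoRQ' = V *m V^H by rewrite VE; exact: psd_sqrt.
have VV : V^H *m V = rdiag lam.
  rewrite VE adjmxM adj_rdiag mulmxA -[_ *m U^H *m U]mulmxA unitarymxVP //.
  by rewrite mulmx1 rdiagM; apply: eq_rdiag => e; rewrite -expr2 sqr_sqrtr.
pose M := regroup V.
have pM := psd_outer M.
have [K [p [hK p0 eqK]]] := psd_spectral pM.
have SR : vN_entropy rho = - (hsum r / ln 2).
  rewrite -ptPsi ptraceA_proj_vec vN_entropy_tr ?vN_entropy_gramC; last first.
    exact: psd_gram.
  by rewrite -vN_entropy_gramC; exact: vN_entropyE eqA.
(* Purity of the state on R, Q' and E gives S(Q') = S(RE), whose spectrum is [p]. *)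
have SQ' : vN_entropy (ptraceA rhoRQ') = - (hsum p / ln 2).
  rewrite -[ptraceA _]trmxK eqV -regroup_gram vN_entropy_tr; last first.
    exact: psd_gram.
  by rewrite -vN_entropy_gramC; exact: vN_entropyE eqK.
(* The left side is [ln 2] times I(R:E)/2, the factor [ln 2] converting bits to nats. *)
have eps_ge : - (hsum r + hsum lam - hsum p) / 2 <= ln 2 * eps.
  have := hE _ _ _ (conj prq trq); rewrite /mutual_info SQ' ptB.
  rewrite (vN_entropyE r0 hA eqA) (vN_entropyE lam0 hU eqU).
  rewrite /eps SR; have [ln20 _] := ln2_bounds R.
  move=> hE'; rewrite [leRHS]mulrC -ler_pdivrMr //.
  have -> : - (hsum r + hsum lam - hsum p) / 2 / ln 2 =
    - (hsum r / ln 2) - (- (hsum r / ln 2) + - (hsum p / ln 2)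
      - - (hsum lam / ln 2)) / 2 by field; rewrite gt_eqF.
  by lra.
have trM : \sum_k p k = 1.
  apply: complexI; rewrite -(mxtrace_spectral _ hK) -eqK -mxtrace_ptraceB.
  by rewrite ptraceB_regroup -eqV mxtrace_ptraceB.
have trlam : \sum_e lam e = 1.
  by apply: complexI; rewrite -(mxtrace_spectral _ hU) -eqU.
(* Purifies the product of the R and E marginals, by Q together with a copy E' of E. *)
pose N := P *t rdiag s.
pose L : 'M[R[i]]_(n * (n * m)) := A *t 1%:M.
pose q x := r (mxtens_unindex x).1 * lam (mxtens_unindex x).2.
have hL : Defs.unitarymx L by exact: unitarymx_tensr.
have eqN : N *m N^H = L *m rdiag q *m L^H.
  rewrite /N /L !adjmx_tens adjmx1 adj_rdiag -rdiag_tens !tensmx_mul.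
  rewrite mul1mx mulmx1 eqA rdiagM; congr (_ *t _); apply: eq_rdiag => e.
  by rewrite -expr2 sqr_sqrtr.
have q0 x : 0 <= q x by rewrite mulr_ge0.
have [G pG trG] := recovery_contraction hK hL p0 q0 eqK eqN.
set f := \sum_k \sum_x _ in trG.
have f0 : 0 <= f.
  apply: sumr_ge0 => k _; apply: sumr_ge0 => x _.
  by rewrite !mulr_ge0 ?sqrtr_ge0 ?sqmod_ge0.
have f_ge : 1 - ln 2 * eps <= f.
  apply: le_trans (overlap_marginals_ge hK hA p0 r0 lam0 trM _ _).
  - by lra.
  - by rewrite -eqK ptraceB_regroup -eqV ptB.
  by rewrite -eqK ptraceA_regroup VV tr_diag_mx.
have pW : psd (1%:M - \sum_e (slice G e)^H *m slice G e).
  by rewrite slice_gram -[1%:M]trmx1 -raddfB; exact: psd_tr.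
(* The discarded weight is sent to the state [P *m P^H], of unit trace by [trP]. *)
have [K' K'E sumK'] := complete_kraus trP pW.
exists (kraus K'); split; first exact: channel_kraus.
rewrite (ent_fidelity_kraus K' eqV) lecR.
have [ln20 ln21] := ln2_bounds R.
apply: le_trans (sqr_ge_sqrt ln20 ln21 f0 f_ge) _.
(* Of all squared amplitudes, only those whose Kraus index equals the environment index are kept;
   the filler operators and the off-diagonal terms are nonnegative. *)
pose c e := (Psi^H *m (1%:M *t slice G e) *m V) 0 e.
apply: (@le_trans _ _ (\sum_e sqmod (c e))).
  apply: (sqr_le_sum_sqmod lam0 trlam).
  by rewrite -trG -amplitude.
rewrite big_sumType /=; apply: ler_wpDr.
  by apply: sumr_ge0 => a _; apply: sumr_ge0 => e _; exact: sqmod_ge0.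
apply: ler_sum => e _; rewrite K'E (bigD1 e) //= lerDl.
by apply: sumr_ge0 => e' _; exact: sqmod_ge0.
Qed.
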